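(* Let $E,F$ be Banach spaces and $T>0$. Let $\eta\in(0,1]$ and $p,q\in[1,\infty)$ be such that $\theta:=\frac1p+\frac\eta q>1$. Let $A\in\mathcal{C}^{p\text{-var}}_{[0,T]}(\mathcal{C}^\eta_{E,loc}(F))$ and $x\in\mathcal{C}^{q\text{-var}}_{[0,T]}(E)$. Then for $0\leqslant s\leqslant t\leqslant T$ and any sequence of partitions $(\Pi_n)_n$ of $[s,t]$ with $\lim_n|\Pi_n|=0$, the sum $\sum_{\Pi_n}A_{t_i,t_{i+1}}(x_{t_i})$ converges in $F$, and the limit is independent of the sequence of partitions $(\Pi_n)_n$. Denote it by $\int_s^tA_{dr}(x_r)$. In addition, there exists $C(\theta)>0$ (depending only on $\theta$) such that for $0\leqslant s\leqslant t\leqslant T$ and $R>0$ with $\|x\|_\infty\leqslant R$, $$\Big\|\int_s^tA_{dr}(x_r)-A_{s,t}(x_s)\Big\|_F\leqslant C(\theta)\,[A]_{\mathcal{C}^{p\text{-var}}_{[s,t]}(\mathcal{C}^\eta_{D_R})}\,[x]^\eta_{\mathcal{C}^{q\text{-var}}_{[s,t]}(E)} .$$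
   Context: For a Banach space $G$, the $p$-variation seminorm of $x:[s,t]\to G$ is $[x]_{\mathcal{C}^{p\text{-var}}_{[s,t]}(G)}=\sup\big(\sum_i\|x_{t_{i+1}}-x_{t_i}\|_G^p\big)^{1/p}$, the supremum over all partitions of $[s,t]$; $\mathcal{C}^{p\text{-var}}_{[s,t]}(G)$ is the set of continuous functions with finite $p$-variation. If $G$ is only a Fréchet space, a function has finite $p$-variation if its $p$-variation is finite with respect to every continuous seminorm. $D_R=\{x\in E:\|x\|_E\leqslant R\}$. For $U\subset E$ and $\eta\in(0,1]$, $\mathcal{C}^\eta_U(F)$ is the space of continuous $f:U\to F$ with $\|f\|_{\mathcal{C}^\eta_U(F)}=\sup_{x\in U}\|f(x)\|_F+\sup_{x\ne y\in U}\|f(x)-f(y)\|_F/\|x-y\|_E^\eta<\infty$. $\mathcal{C}^\eta_{E,loc}(F)$ is the space of continuous $f:E\to F$ with $\|f\|_{\mathcal{C}^\eta_{D_R}(F)}<\infty$ for all $R>0$ (a Fréchet space with these seminorms). $[A]_{\mathcal{C}^{p\text{-var}}_{[s,t]}(\mathcal{C}^\eta_{D_R})}$ is the $p$-variation of $A$ on $[s,t]$ with respect to $\|\cdot\|_{\mathcal{C}^\eta_{D_R}(F)}$. $A_{s,t}:=A_t-A_s$; $|\Pi|$ is the mesh of a partition $\Pi=(s=t_0<\dots<t_N=t)$, and $\sum_\Pi A_{t_i,t_{i+1}}(x_{t_i})=\sum_{i=0}^{N-1}A_{t_i,t_{i+1}}(x_{t_i})$. $\|x\|_\infty=\sup_{t\in[0,T]}\|x_t\|_E$.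 *)

(* Defs.v *)
From HB Require Import structures.
From mathcomp Require Import all_boot all_order all_algebra.
From mathcomp Require Import all_classical all_reals all_analysis.

Set Implicit Arguments.
Unset Strict Implicit.
Unset Printing Implicit Defensive.

Import Order.TTheory GRing.Theory Num.Theory.
Import numFieldNormedType.Exports.

Local Open Scope classical_set_scope.
Local Open Scope ring_scope.

(* Supremum in [0, +oo] of a set of nonnegative extended reals; adjoining 0
   gives the value 0, instead of -oo, to the supremum of the empty set. *)
Definition esup0 (R : realType) (S : set (\bar R)) : \bar R :=
  ereal_sup (0%E |` S).

Lemma esup0_ge0 (R : realType) (S : set (\bar R)) : (0 <= esup0 S)%E.
Proof. by apply: ereal_sup_ubound; left. Qed.

Lemma esup0_ub (R : realType) (S : set (\bar R)) (y : \bar R) :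
  S y -> (y <= esup0 S)%E.
Proof. by move=> Sy; apply: ereal_sup_ubound; right. Qed.

Lemma esup0_le (R : realType) (S : set (\bar R)) (m : \bar R) :
  (0 <= m)%E -> (forall y, S y -> (y <= m)%E) -> (esup0 S <= m)%E.
Proof. by move=> m0 Sm; apply: ge_ereal_sup => y [->//|/Sm]. Qed.

Section partitions.
Context {R : realType}.
Implicit Types (a b : R) (s : seq R).

(* As in [itv_partition a b s], the partition a = t_0 < ... < t_N = b is encoded
   by its left end point a and the sequence s = [:: t_1; ...; t_N]. *)
Definition mesh a s : R :=
  \big[Num.max/0]_(0 <= i < size s) (nth a (a :: s) i.+1 - nth a (a :: s) i).

Definition partition_sum (M : nmodType) (g : R -> R -> M) a s : M :=
  \sum_(0 <= i < size s) g (nth a (a :: s) i) (nth a (a :: s) i.+1).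

(* The p-variation on [a, b] of a path x with values in G, with respect to a
   (semi)norm N on G which is allowed to take the value +oo. *)
Definition pvar (G : zmodType) (N : G -> \bar R) (p a b : R) (x : R -> G)
    : \bar R :=
  let dx s i := x (nth a (a :: s) i.+1) - x (nth a (a :: s) i) in
  (esup0 [set \sum_(0 <= i < size s) N (dx s i) `^ p | s in itv_partition a b]
   `^ p^-1)%E.

End partitions.

Definition norme (R : realType) (V : normedModType R) (v : V) : \bar R :=
  `|v|%:E.

Definition Cpvar (R : realType) (G : normedModType R) (p a b : R)
    : set (R -> G) :=
  [set x | {within `[a, b], continuous x} /\
           (pvar (@norme R G) p a b x < +oo)%E].

Definition seminorm (R : realType) (G : lmodType R) (N : G -> R) : Prop :=
  (forall u v, N (u + v) <= N u + N v) /\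
  (forall (c : R) u, N (c *: u) = `|c| * N u).

Definition Cpvar_tvs (R : realType) (G : preTopologicalLmodType R) (p a b : R)
    : set (R -> G) :=
  [set x | {within `[a, b], continuous x} /\
           forall N : G -> R, seminorm N -> continuous N ->
             (pvar (fun v => (N v)%:E) p a b x < +oo)%E].

Definition Dball (R : realType) (E : normedModType R) (r : R) : set E :=
  [set x | `|x| <= r].
Arguments Dball {R} E r.

Section hoelder_norm.
Context {R : realType} {E F : normedModType R}.
Implicit Types (eta : R) (U : set E) (f g : E -> F).

Definition hoelder_norm eta U f : \bar R :=
  (esup0 [set `|f x|%:E | x in U] +
   esup0 [set (`|f xy.1 - f xy.2| / `|xy.1 - xy.2| `^ eta)%:E
         | xy in [set xy : E * E | [/\ U xy.1, U xy.2 & xy.1 <> xy.2]]])%E.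

Lemma hoelder_norm_ge0 eta U f : (0 <= hoelder_norm eta U f)%E.
Proof. by rewrite adde_ge0 ?esup0_ge0. Qed.

Lemma hoelder_normD eta U f g :
  (hoelder_norm eta U (f + g)%R <= hoelder_norm eta U f + hoelder_norm eta U g)%E.
Proof.
rewrite /hoelder_norm addeACA; apply: leeD; apply: esup0_le.
- by rewrite adde_ge0 ?esup0_ge0.
- move=> _ [x Ux <-]; apply: (@le_trans _ _ (`|f x|%:E + `|g x|%:E)%E).
    by rewrite -EFinD lee_fin; exact: ler_normD.
  by apply: leeD; apply: esup0_ub; exists x.
- by rewrite adde_ge0 ?esup0_ge0.
- move=> _ [[x y] /= Uxy <-].
  apply: (@le_trans _ _ ((`|f x - f y| / `|x - y| `^ eta)%:E +
                         (`|g x - g y| / `|x - y| `^ eta)%:E)%E).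
    rewrite -EFinD lee_fin -mulrDl ler_wpM2r ?invr_ge0 ?powR_ge0//.
    have -> : (f + g) x - (f + g) y = (f x - f y) + (g x - g y).
      by rewrite !fctE opprD addrACA.
    exact: ler_normD.
  by apply: leeD; apply: esup0_ub; exists (x, y).
Qed.

Lemma hoelder_normZ eta U (c : R) f :
  (hoelder_norm eta U (c *: f)%R <= `|c|%:E * hoelder_norm eta U f)%E.
Proof.
rewrite /hoelder_norm ge0_muleDr ?esup0_ge0//; apply: leeD; apply: esup0_le.
- by rewrite mule_ge0 ?esup0_ge0// lee_fin.
- move=> _ [x Ux <-]; rewrite normrZ EFinM.
  by apply: lee_wpmul2l; rewrite ?lee_fin//; apply: esup0_ub; exists x.
- by rewrite mule_ge0 ?esup0_ge0// lee_fin.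
- move=> _ [[x y] /= Uxy <-]; rewrite -scalerBr normrZ -mulrA EFinM.
  by apply: lee_wpmul2l; rewrite ?lee_fin//; apply: esup0_ub; exists (x, y).
Qed.

Lemma hoelder_norm0 eta U : hoelder_norm eta U 0 = 0%E.
Proof.
apply/eqP; rewrite eq_le hoelder_norm_ge0 andbT.
by rewrite -(scale0r (0 : E -> F)) (le_trans (hoelder_normZ _ _ _ _))// normr0 mul0e.
Qed.

Lemma hoelder_normN eta U f : hoelder_norm eta U (- f) = hoelder_norm eta U f.
Proof.
suff H g : (hoelder_norm eta U (- g)%R <= hoelder_norm eta U g)%E.
  by apply/eqP; rewrite eq_le H/= -{1}(opprK f) H.
by rewrite -scaleN1r (le_trans (hoelder_normZ _ _ _ _))// normrN1 mul1e.
Qed.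

End hoelder_norm.

Section hoelder_loc.
Context {R : realType} (E F : normedModType R) (eta : R).

Definition hoelder_loc_pred : {pred E -> F} := mem [set f : E -> F |
  continuous f /\
  forall r : R, 0 < r -> (hoelder_norm eta (Dball E r) f < +oo)%E].

Lemma hoelder_loc_submod_closed : submod_closed hoelder_loc_pred.
Proof.
split=> [|c f g]; rewrite !inE.
  split=> [x|r r0]; first exact: cvg_cst.
  by rewrite hoelder_norm0.
move=> [cf nf] [cg ng]; split=> [x|r r0].
  by apply: cvgD; [apply: cvgZr; exact: cf|exact: cg].
apply: le_lt_trans (hoelder_normD _ _ _ _) _.
apply: lte_add_pinfty; last exact: ng.
apply: le_lt_trans (hoelder_normZ _ _ _ _) _.
by rewrite lte_mul_pinfty ?lee_fin// nf.
Qed.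

HB.instance Definition _ := GRing.isSubmodClosed.Build R (E -> F)
  hoelder_loc_pred hoelder_loc_submod_closed.

Record hoelder_loc := HoelderLoc {
  hl_fun :> E -> F ;
  hl_funP : hl_fun \in hoelder_loc_pred }.

HB.instance Definition _ := [isSub for hl_fun].
HB.instance Definition _ := [Choice of hoelder_loc by <:].
HB.instance Definition _ := [SubChoice_isSubLmodule of hoelder_loc by <:].

Local Notation N r f := (hoelder_norm eta (Dball E r) (hl_fun f)).

(* The uniform structure (hence the topology) defined by the family of
   seminorms f |-> hoelder_norm eta (Dball E r) f, r > 0. *)
Definition hl_entourage : set_system (hoelder_loc * hoelder_loc) :=
  [set P | exists r e : R, [/\ 0 < r, 0 < e &
    forall f g : hoelder_loc, (N r (f - g)%R < e%:E)%E -> P (f, g)]].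

Lemma Dball_norm_le (r1 r2 : R) (f : E -> F) : r1 <= r2 ->
  (hoelder_norm eta (Dball E r1) f <= hoelder_norm eta (Dball E r2) f)%E.
Proof.
move=> r12; apply: leeD; apply: esup0_le; rewrite ?esup0_ge0//.
  move=> _ [x Dx <-]; apply: esup0_ub; exists x => //.
  exact: le_trans Dx r12.
move=> _ [[x y] /= [Dx Dy xy] <-]; apply: esup0_ub; exists (x, y) => //.
by split => //; apply: le_trans r12.
Qed.

Local Lemma hl_entourage_filter : Filter hl_entourage.
Proof.
split=> [|P Q [r1 [e1 [r10 e10 H1]]] [r2 [e2 [r20 e20 H2]]]|P Q PQ [r [e [r0 e0 H]]]].
- by exists 1, 1.
- exists (Num.max r1 r2), (Num.min e1 e2); split.
  + by rewrite lt_max r10.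
  + by rewrite lt_min e10.
  + move=> f g fg; split.
      apply: H1; apply: le_lt_trans (Dball_norm_le _ _) (lt_le_trans fg _).
        by rewrite le_max lexx.
      by rewrite lee_fin ge_min lexx.
    apply: H2; apply: le_lt_trans (Dball_norm_le _ _) (lt_le_trans fg _).
      by rewrite le_max lexx orbT.
    by rewrite lee_fin ge_min lexx orbT.
- by exists r, e; split=> // f g /H/PQ.
Qed.

Local Lemma hl_entourage_diagonal P : hl_entourage P -> diagonal `<=` P.
Proof.
move=> [r [e [r0 e0 H]]] [f g] /= fg; have -> : f = g by exact: fg.
by apply: H; rewrite subrr hoelder_norm0 lte_fin.
Qed.

Local Lemma hl_entourage_inv P : hl_entourage P -> hl_entourage P^-1%relation.
Proof.
move=> [r [e [r0 e0 H]]]; exists r, e; split=> // f g fg.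
by apply: H; rewrite -hoelder_normN opprB.
Qed.

Local Lemma hl_entourage_split P : hl_entourage P ->
  exists2 Q, hl_entourage Q & (Q \; Q `<=` P)%relation.
Proof.
move=> [r [e [r0 e0 H]]].
exists [set fg | (N r (fg.1 - fg.2)%R < (e / 2)%:E)%E].
  by exists r, (e / 2); split=> //; rewrite divr_gt0.
move=> [f g] /= [h /= fh hg]; apply: H; rewrite -(subrKA h) [e]splitr EFinD.
by apply: le_lt_trans (hoelder_normD _ _ _ _) _; exact: lteD.
Qed.

HB.instance Definition _ := isUniform.Build hoelder_loc
  hl_entourage_filter hl_entourage_diagonal
  hl_entourage_inv hl_entourage_split.

End hoelder_loc.

Lemma hl_norm_fin_num (R : realType) (E F : normedModType R) (eta r : R)
    (f : hoelder_loc E F eta) : 0 < r ->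
  hoelder_norm eta (Dball E r) f \is a fin_num.
Proof.
move=> r0; rewrite ge0_fin_numE ?hoelder_norm_ge0//.
by have := hl_funP f; rewrite inE => -[_ /(_ _ r0)].
Qed.

Lemma hl_norm_continuous (R : realType) (E F : normedModType R) (eta r : R) :
  0 < r ->
  continuous
    (fun f : hoelder_loc E F eta => fine (hoelder_norm eta (Dball E r) f)).
Proof.
set N := (fun f : hoelder_loc E F eta => _) => r0 f.
have FF := @nbhs_filter _ f.
apply: (@cvgrPdist_lt _ _ _ _ FF _ _).2 => e e0.
have tri g h : N (g + h) <= N g + N h.
  by rewrite -lee_fin EFinD /N !fineK ?hl_norm_fin_num//; exact: hoelder_normD.
rewrite -nbhs_entourageE.
exists [set fg | (hoelder_norm eta (Dball E r) (hl_fun (fg.1 - fg.2)%R) < e%:E)%E].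
  by exists r, e; split.
move=> g; rewrite /xsection /= inE /= => h.
have {}h : N (f - g) < e.
  by rewrite -lte_fin /N fineK ?hl_norm_fin_num.
have Nn u : N (- u) = N u by rewrite /N hoelder_normN.
rewrite ltr_norml; apply/andP; split.
  rewrite ltrNl opprB ltrBlDr -{1}(subrK f g); apply: le_lt_trans (tri _ _) _.
  by rewrite ltrD2r -opprB Nn.
rewrite ltrBlDr -{1}(subrK g f); apply: le_lt_trans (tri _ _) _.
by rewrite ltrD2r.
Qed.

Lemma hl_norm_seminorm (R : realType) (E F : normedModType R) (eta r : R) :
  0 < r ->
  seminorm
    (fun f : hoelder_loc E F eta => fine (hoelder_norm eta (Dball E r) f)).
Proof.
move=> r0; have Z (c : R) (f : hoelder_loc E F eta) :
    fine (hoelder_norm eta (Dball E r) (c *: f)) <=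
    `|c| * fine (hoelder_norm eta (Dball E r) f).
  by rewrite -lee_fin EFinM !fineK ?hl_norm_fin_num//; exact: hoelder_normZ.
split=> [f g|c f].
  by rewrite -lee_fin EFinD !fineK ?hl_norm_fin_num//; exact: hoelder_normD.
apply/eqP; rewrite eq_le Z/=; have [->|c0] := eqVneq c 0.
  by rewrite normr0 mul0r fine_ge0 ?hoelder_norm_ge0.
by rewrite -ler_pdivlMl ?normr_gt0// -normfV -{1}(scalerK c0 f) Z.
Qed.

Definition sup_norm (R : realType) (E : normedModType R) (T : R) (x : R -> E)
    : \bar R :=
  esup0 [set `|x t|%:E | t in `[0, T]].

(* [I] is the limit of the sums of A_{t_i, t_{i+1}}(x_{t_i}) along every
   sequence of partitions of [s, t] whose mesh tends to 0. *)
Definition is_nonlinear_young_integral (R : realType) (E F : normedModType R)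
    (eta : R) (A : R -> hoelder_loc E F eta) (x : R -> E) (s t : R) (I : F)
    : Prop :=
  forall Pi : nat -> seq R,
    (forall n, itv_partition s t (Pi n)) ->
    mesh s (Pi n) @[n --> \oo] --> 0 ->
    partition_sum (fun u v => (A v - A u) (x u)) s (Pi n) @[n --> \oo] --> I.

(* Main.v *)
(* Young's argument. For the germ g(u, v) = A_{u,v}(x_u), deleting y from
   u < y < z changes the sum by A_{y,z}(x_y) - A_{y,z}(x_u), of norm at most
   |A_{y,z}| |x_y - x_u|^eta. Since sum |A_{y,z}|^p and sum |x_y - x_u|^q along a
   partition are bounded by the p- and q-variations, a cheapest of M deletable
   points costs at most (2/M)^theta [A] [x]^eta, and sum_M (2/M)^theta converges.
   Deleting every interior point gives the estimate. Deleting from a refinement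
   the points not in the original partition, with q replaced by a slightly larger
   q' so that the q'-variation at small scales is small, gives the Cauchy
   property. *)

Require Import Defs.
From mathcomp Require Import all_boot all_order all_algebra.
From mathcomp Require Import all_classical all_reals all_analysis.
From mathcomp Require Import lra.

Set Implicit Arguments.
Unset Strict Implicit.
Unset Printing Implicit Defensive.

Import Order.TTheory GRing.Theory Num.Theory.
Import numFieldNormedType.Exports.

Local Open Scope classical_set_scope.
Local Open Scope ring_scope.

(** * Sums over partitions and mesh, unfolded point by point *)

Lemma partition_sum_nil (R : realType) (M : nmodType) (g : R -> R -> M) a :
  partition_sum g a [::] = 0.
Proof. by rewrite /partition_sum big_geq. Qed.

Lemma partition_sum_cons (R : realType) (M : nmodType) (g : R -> R -> M) a y s :
  partition_sum g a (y :: s) = g a y + partition_sum g y s.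
Proof.
rewrite /partition_sum /= big_nat_recl//=; congr (_ + _).
apply: eq_big_nat => i /andP[_ si]; congr (g _ _); last exact: set_nth_default.
by apply: (set_nth_default y a); rewrite /= ltnS ltnW.
Qed.

Lemma partition_sum_cat (R : realType) (M : nmodType) (g : R -> R -> M) a s1 s2 :
  partition_sum g a (s1 ++ s2) =
  partition_sum g a s1 + partition_sum g (last a s1) s2.
Proof.
elim: s1 a => [|y s1 IH] a /=; first by rewrite partition_sum_nil add0r.
by rewrite !partition_sum_cons IH addrA.
Qed.

Lemma partition_sum_ge0 (R : realType) (M : numDomainType) (g : R -> R -> M)
    a s :
  (forall u v, 0 <= g u v) -> 0 <= partition_sum g a s.
Proof. by move=> g0; apply: sumr_ge0. Qed.

Lemma partition_sum_le (R : realType) (M : numDomainType) (f g : R -> R -> M)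
    a s :
  path (fun u v => f u v <= g u v) a s ->
  partition_sum f a s <= partition_sum g a s.
Proof.
elim: s a => [|y s IH] a /=; first by rewrite !partition_sum_nil.
by case/andP=> fg /IH H; rewrite !partition_sum_cons lerD.
Qed.

Lemma mul_partition_sum (R : realType) (M : pzRingType) (g : R -> R -> M) c a s :
  c * partition_sum g a s = partition_sum (fun u v => c * g u v) a s.
Proof. by rewrite /partition_sum big_distrr. Qed.

Lemma mesh_cons (R : realType) (a y : R) s :
  mesh a (y :: s) = Num.max (y - a) (mesh y s).
Proof.
rewrite /mesh /= big_nat_recl//=; congr (Num.max _ _).
apply: eq_big_nat => i /andP[_ si]; congr (_ - _); first exact: set_nth_default.
by apply: (set_nth_default y a); rewrite /= ltnS ltnW.
Qed.

Lemma mesh_nil (R : realType) (a : R) : mesh a [::] = 0.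
Proof. by rewrite /mesh big_geq. Qed.

Lemma mesh_ge0 (R : realType) (a : R) s : 0 <= mesh a s.
Proof.
elim: s a => [|y s IH] a; first by rewrite mesh_nil.
by rewrite mesh_cons le_max IH orbT.
Qed.

(** * Young's point-deletion argument and its constant *)

(* Pigeonhole over the removable points, i.e. those outside [K]. *)
Lemma cheap_point (R : realType) (K : pred R) (c1 c2 : R -> R -> R) tau a s :
  (forall u v, 0 <= c1 u v) -> (forall u v, 0 <= c2 u v) ->
  K (last a s) -> (0 < count (predC K) s)%N ->
  partition_sum c1 a s + partition_sum c2 a s <= tau *+ count (predC K) s ->
  exists s1 y z s2, [/\ s = s1 ++ y :: z :: s2, ~~ K y &
    c2 (last a s1) y + c1 y z <= tau].
Proof.
move=> c10 c20 Kl M0 Hs.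
suff: ~ (forall s1 y z s2, s = s1 ++ y :: z :: s2 -> ~~ K y ->
    tau < c2 (last a s1) y + c1 y z).
  apply: contra_notP => H s1 y z s2 E Ky; rewrite ltNge; apply/negP => le.
  by apply: H; exists s1, y, z, s2.
move=> H; move: Hs; apply/negP; rewrite -ltNge.
(* Each point is charged [c2] of the interval on its left and [c1] of the one on its right, so each
   interval counts at most once per cost; [c1] of the first interval is dropped. *)
apply: (@lt_le_trans _ _ (partition_sum c2 a s +
   partition_sum c1 (head a s) (behead s))); last first.
  rewrite addrC lerD2r; case: s {Kl M0 H} => [|y s]; first by [].
  by rewrite partition_sum_cons /= lerDr.
elim: s a Kl M0 H => [//|y s IH] a /= Kl M0 H.
rewrite partition_sum_cons -addrA.
(* The last point is in [K], so a one-point tail has nothing to remove. *)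
case: s IH Kl M0 H => [|z s] IH Kl M0 H; first by rewrite /= Kl in M0.
have {}IH : (0 < count (predC K) (z :: s))%N ->
    tau *+ count (predC K) (z :: s) < partition_sum c2 y (z :: s) +
       partition_sum c1 z s.
  move=> M1; apply: IH => // s1 u v s2 E Ku.
  by have := H (y :: s1) u v s2; rewrite /= E => /(_ erefl Ku).
rewrite (partition_sum_cons c1).
have S0 : 0 <= partition_sum c2 y (z :: s) + partition_sum c1 z s.
  by rewrite addr_ge0 ?partition_sum_ge0.
have := H [::] y z s erefl.
move: IH M0; set k := count _ _; case: (boolP (K y)) => Ky /=.
  rewrite !add0n => IH /IH + _.
  by have := c20 a y; have := c10 y z; lra.
move=> IH _ /(_ isT); rewrite add1n mulrS.
(* With no removable point after [y], the induction hypothesis is void: strictness comes from [y]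
   alone, and the rest is nonnegative by [S0]. *)
case: k IH => [_|k /(_ isT)]; rewrite ?mulr0n; lra.
Qed.

Lemma subr1_powR2_gt0 (R : realType) (theta : R) :
  1 < theta -> 0 < 1 - 2 `^ (1 - theta).
Proof.
move=> t1; rewrite subr_gt0 /powR pnatr_eq0/= -[ltRHS]expR0 ltr_expR.
by rewrite pmulr_llt0 ?subr_lt0// ln_gt0 ?ltr1n.
Qed.

(* Grouping the terms of index [2m] and [2m+1] gives
   [S (2n+1) <= 1 + 2 `^ (1 - theta) * S n] for the partial sums [S]. *)
Lemma zeta_sum_le (R : realType) (theta : R) n : 1 < theta ->
  \sum_(0 <= m < n) m.+1%:R `^ (- theta) <= (1 - 2 `^ (1 - theta))^-1.
Proof.
move=> t1; set S := fun n => \sum_(0 <= m < n) m.+1%:R `^ (- theta).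
set rho := 2 `^ (1 - theta); rewrite -/(S n).
have rho1 : 0 < 1 - rho := subr1_powR2_gt0 t1.
have SS k : S k.+1 = S k + k.+1%:R `^ (- theta) by rewrite /S big_nat_recr.
have S2 k : S k.*2.+1 <= 1 + rho * S k.
  elim: k => [|k IH].
    by rewrite SS /S !big_geq// mulr0 add0r addr0 powR1.
  have le32 : k.*2.+3%:R `^ (- theta) <= k.*2.+2%:R `^ (- theta).
    rewrite !powRN lef_pV2 ?posrE ?powR_gt0 ?ltr0n//.
    by rewrite ge0_ler_powR ?nnegrE ?ler_nat//; lra.
  have E2 : k.*2.+2%:R `^ (- theta) *+ 2 = rho * k.+1%:R `^ (- theta).
    rewrite -doubleS -mul2n natrM powRM// -mulrnAl /rho powRD.
      by rewrite powRr1// mulr_natl.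
    by rewrite pnatr_eq0 implybT.
  by rewrite doubleS SS SS (SS k) mulrDr; move: IH le32 E2; lra.
have Smono : S n <= S n.*2.+1.
  apply: (homo_leq (r := <=%R)) => //; first exact: le_trans.
    by move=> k; rewrite SS lerDl powR_ge0.
  by rewrite -addnn leqW// leq_addl.
(* [S n <= S (2n+1) <= 1 + rho * S n] is solved for [S n], using [rho < 1]. *)
by have := le_trans Smono (S2 n); rewrite -div1r ler_pdivlMr//; lra.
Qed.

(** The bound of [zeta_sum_le] times the power of 2 that comes from the factors [2 / M]; an explicit
    majorant of 2^theta zeta(theta). *)
Definition young_const (R : realType) (theta : R) : R :=
  2 `^ theta * (1 - 2 `^ (1 - theta))^-1.

Lemma young_const_gt0 (R : realType) (theta : R) :
  1 < theta -> 0 < young_const theta.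
Proof.
by move=> t1; rewrite mulr_gt0 ?powR_gt0// invr_gt0 subr1_powR2_gt0.
Qed.

(* [c <= W] covers the degenerate case [W = 0], where [W^-1 = 0]. *)
Lemma le_mul_of_div (R : realFieldType) (c W t : R) :
  0 <= c -> c <= W -> W^-1 * c <= t -> c <= t * W.
Proof.
move=> c0 cW; have [W0|W0] := eqVneq W 0; first by rewrite W0 mulr0 -W0.
have W1 : 0 < W by rewrite lt_def W0 (le_trans c0).
by rewrite ler_pdivrMl// mulrC.
Qed.

(* Young's argument: delete the points outside [K] one at a time, always a
   cheapest one. With [M] of them left, the cheapest costs at most
   [(2 / M) `^ (al + be) * (W1 `^ al * W2 `^ be)]. *)
Lemma partition_sum_coarsen (R : realType) (F : normedModType R)
    (g : R -> R -> F) (c1 c2 : R -> R -> R) (K D : pred R)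
    (al be W1 W2 a : R) s :
  0 < al -> 0 < be -> 1 < al + be ->
  (forall u v, 0 <= c1 u v) -> (forall u v, 0 <= c2 u v) ->
  (forall u y z, D u -> D y -> D z ->
    `|g u y + g y z - g u z| <= c1 y z `^ al * c2 u y `^ be) ->
  (forall s', subseq s' s -> subseq (seq.filter K s) s' ->
    last a s' = last a s ->
    partition_sum c1 a s' <= W1 /\ partition_sum c2 a s' <= W2) ->
  all D (a :: s) -> K (last a s) ->
  `|partition_sum g a s - partition_sum g a (seq.filter K s)| <=
  young_const (al + be) * (W1 `^ al * W2 `^ be).
Proof.
move=> al0 be0 ab1 c10 c20 gc; set th := al + be; set W := W1 `^ al * W2 `^ be.
have W0 : 0 <= W by rewrite mulr_ge0 ?powR_ge0.
(* Induction on the number of points to delete: the deletion made with [m.+1] of them left pays for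
   the term of index [m] of the truncated series. *)
move=> HW Ds Ks; apply: (@le_trans _ _
    ((2 `^ th * \sum_(0 <= m < count (predC K) s) m.+1%:R `^ (- th)) * W)).
  move E : (count (predC K) s) => M.
  elim: M s E HW Ds Ks => [|M IH] s E HW Ds Ks.
    suff /all_filterP -> : all K s by rewrite subrr normr0 big_geq// mulr0 mul0r.
    by rewrite -(eq_all (a1 := predC (predC K))) ?all_predC ?has_count ?E// => u;
       rewrite /= negbK.
  have [W1s W2s] := HW s (subseq_refl s) (filter_subseq K s) erefl.
  have div1 (S V : R) : 0 <= S -> S <= V -> V^-1 * S <= 1.
    move=> S0 SV; have [->|V0] := eqVneq V 0; first by rewrite invr0 mul0r.
    by rewrite mulrC ler_pdivrMr ?mul1r// lt_def V0 (le_trans S0).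
  have inv0 (S V : R) : 0 <= S -> S <= V -> 0 <= V^-1.
    by move=> S0 SV; rewrite invr_ge0 (le_trans S0).
  have s10 := partition_sum_ge0 a s c10; have s20 := partition_sum_ge0 a s c20.
  (* Division by [W1] and [W2] brings each cost sum down to at most 1, so some point has both
     rescaled costs at most [2 / M.+1]. *)
  have [|||||s1 [y [z [s2 [sE Ky cyz]]]]] :=
    @cheap_point R K (fun u v => W1^-1 * c1 u v) (fun u v => W2^-1 * c2 u v)
      (2 / M.+1%:R) a s.
  - by move=> u v; rewrite mulr_ge0// (inv0 _ _ s10).
  - by move=> u v; rewrite mulr_ge0// (inv0 _ _ s20).
  - by [].
  - by rewrite E.
  - rewrite E -!mul_partition_sum -[leRHS]mulr_natr divfK ?pnatr_eq0//.
    by rewrite -[2]/(1 + 1) lerD// div1.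
  have Du : [/\ D (last a s1), D y & D z].
    move: Ds; rewrite sE -cat_cons all_cat => /andP[/allP D1 /= /and3P[-> -> _]].
    by split=> //; apply: D1; exact: mem_last.
  case: Du => Du Dy Dz.
  set s' := s1 ++ z :: s2.
  have s's : subseq s' s by rewrite sE cat_subseq// subseq_cons.
  have fs' : seq.filter K s' = seq.filter K s.
    by rewrite sE !filter_cat [seq.filter K (y :: _)]/= (negbTE Ky).
  have ls' : last a s' = last a s by rewrite sE !last_cat.
  have Es' : count (predC K) s' = M.
    move: E; rewrite sE !count_cat /= Ky.
    by rewrite add1n addnS => -[].
  have {}IH := IH s' Es'.
  have cy1 : c1 y z <= W1.
    apply: le_trans W1s; rewrite sE partition_sum_cat !partition_sum_cons.
    have := partition_sum_ge0 a s1 c10; have := partition_sum_ge0 z s2 c10.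
    by have := c10 (last a s1) y; lra.
  have cy2 : c2 (last a s1) y <= W2.
    apply: le_trans W2s; rewrite sE partition_sum_cat !partition_sum_cons.
    have := partition_sum_ge0 a s1 c20; have := partition_sum_ge0 z s2 c20.
    by have := c20 y z; lra.
  have W10 : 0 <= W1 := le_trans s10 W1s.
  have W20 : 0 <= W2 := le_trans s20 W2s.
  have t0 : 0 <= 2 / M.+1%:R :> R by rewrite divr_ge0.
  have {cy1}cy1 : c1 y z <= (2 / M.+1%:R) * W1.
    apply: le_mul_of_div => //; apply: le_trans cyz; rewrite lerDr.
    by rewrite mulr_ge0 ?invr_ge0.
  have {cy2}cy2 : c2 (last a s1) y <= (2 / M.+1%:R) * W2.
    apply: le_mul_of_div => //; apply: le_trans cyz; rewrite lerDl.
    by rewrite mulr_ge0 ?invr_ge0.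
  rewrite -fs' -(subrKA (partition_sum g a s')) big_nat_recr//= mulrDr mulrDl.
  rewrite [leRHS]addrC; apply: le_trans (ler_normD _ _) (lerD _ _); last first.
    apply: IH; last by rewrite ls'.
    (* What lies between the kept points and [s'] also lies between them and [s], so [W1] and [W2]
       serve unchanged. *)
    - move=> s'' s1'' s2'' l''; apply: HW.
      + exact: subseq_trans s's.
      + by rewrite -fs'.
      + by rewrite l''.
    - apply/allP => v vs'; apply: (allP Ds); move: vs'; rewrite !inE.
      by move=> /orP[->//|/(mem_subseq s's)->]; rewrite orbT.
  (* Only the terms next to [y] survive: the change is [g u y + g y z - g u z] with
     [u = last a s1]. *)
  rewrite sE !partition_sum_cat !partition_sum_cons opprD addrACA subrr add0r.
  rewrite [g _ y + _]addrA opprD addrACA subrr addr0.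
  apply: le_trans (gc _ _ _ Du Dy Dz) _.
  have -> : 2 `^ th * M.+1%:R `^ (- th) * W =
      ((2 / M.+1%:R) * W1) `^ al * ((2 / M.+1%:R) * W2) `^ be.
    rewrite (powRM al t0 W10) (powRM be t0 W20) [RHS]mulrACA -powRD; last first.
      by apply/implyP; rewrite gt_eqF//; lra.
    by rewrite powRM ?invr_ge0// -[_^-1]powR_inv1// -powRrM mulN1r.
  by apply: ler_pM; rewrite ?powR_ge0//; apply: ge0_ler_powR => //;
    rewrite ?nnegrE ?mulr_ge0 ?(ltW al0) ?(ltW be0).
by rewrite ler_wpM2r// ler_wpM2l ?powR_ge0// zeta_sum_le.
Qed.

(** * Partitions of an interval: refinement and mesh *)

Lemma itv_partition_mem (R : realType) (a b u : R) s :
  itv_partition a b s -> u \in a :: s -> a <= u <= b.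
Proof.
move=> [ps /eqP <-]; elim: s a ps u => [|y s IH] a /=.
  by move=> _ u; rewrite inE => /eqP ->; rewrite lexx.
move=> /andP[ay /IH{}IH] u; rewrite inE => /predU1P[->|/IH/andP[yu ->]].
  have /andP[_ yl] := IH y (mem_head _ _).
  by rewrite lexx/= (le_trans (ltW ay)).
by rewrite (le_trans (ltW ay) yu).
Qed.

Lemma itv_partition_subseq (R : realType) (a b : R) s s' :
  itv_partition a b s -> subseq s' s -> last a s' = last a s ->
  itv_partition a b s'.
Proof.
move=> [ps ls] ss' l'; split; last by rewrite l'.
exact: subseq_lt_path ss' ps.
Qed.

(** The sorted union of the two. Refinement is expressed by filters because [partition_sum_coarsen]
    deletes points in this form. *)
Lemma itv_partition_common_refinement (R : realType) (a b : R) s1 s2 :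
  itv_partition a b s1 -> itv_partition a b s2 ->
  exists s, [/\ itv_partition a b s, [seq u <- s | u \in s1] = s1 &
                [seq u <- s | u \in s2] = s2].
Proof.
move=> P1 P2; case: (P1) (P2) => [p1 l1] [p2 l2].
pose s := sort <=%R (undup (s1 ++ s2)).
have ms : s =i s1 ++ s2 by move=> u; rewrite mem_sort mem_undup.
have ss : sorted <%R s by rewrite sort_lt_sorted undup_uniq.
have ps : path <%R a s.
  rewrite lt_path_sortedE ss andbT; apply/allP => u.
  rewrite ms mem_cat; move: p1 p2; rewrite !lt_path_sortedE.
  by case/andP=> /allP a1 _ /andP[/allP a2 _] /orP[/a1|/a2].
have sub s' : path <%R a s' -> {subset s' <= s} -> [seq u <- s | u \in s'] = s'.
  move=> p' s's; apply: lt_sorted_eq.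
  - exact: lt_sorted_filter ss.
  - exact: path_sorted p'.
  - by move=> u; rewrite mem_filter; case: (boolP (u \in s')) => // /s's ->.
exists s; split; last 2 first.
- by apply: sub => // u u1; rewrite ms mem_cat u1.
- by apply: sub => // u u2; rewrite ms mem_cat u2 orbT.
split=> //; have sb u : u \in s -> u <= b.
  rewrite ms mem_cat => us.
  suff /andP[] : a <= u <= b by [].
  by case/orP: us => us; [apply: itv_partition_mem P1 _|
    apply: itv_partition_mem P2 _]; rewrite inE us orbT.
(* If [a = b], both partitions are empty. Otherwise [b] belongs to [s] and, being an upper bound of
   it, must come last. *)
have [ab|ab] := eqVneq a b.
  have E2 : s2 = [::] by apply: (@itv_partitionxx _ _ a); rewrite {2}ab.
  have E1 : s1 = [::] by apply: (@itv_partitionxx _ _ a); rewrite {2}ab.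
  by rewrite /s E1 E2 /= ab.
have : b \in s.
  rewrite ms mem_cat; case: (s1) l1 => [/=|y s0 /= /eqP <-].
    by rewrite (negbTE ab).
  by rewrite mem_last.
move=> bs; case/splitPr: bs ps sb => t1 [|z t2]; rewrite last_cat//= => ps sb.
have := sb z; rewrite mem_cat !inE eqxx !orbT => /(_ isT).
by move: ps; rewrite cat_path /= => /and4P[_ _ bz _]; rewrite leNgt bz.
Qed.

(** Consecutive points cannot straddle a point that is itself on the path. The alternative [k <= a]
    takes in the points already passed during the induction. *)
Lemma path_separated (R : realType) (a : R) (P s : seq R) :
  path <%R a s -> {in P, forall k, k <= a \/ k \in s} ->
  path (fun u v => (u < v) && all (fun k => (k <= u) || (v <= k)) P) a s.
Proof.
elim: s a => [//|y s IH] a /= /andP[ay ps] HP.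
have ys k : k \in s -> y < k.
  by move: ps; rewrite lt_path_sortedE => /andP[/allP H _] /H.
rewrite ay/=; apply/andP; split.
  apply/allP => k /HP[->//|]; rewrite inE => /predU1P[->|/ys/ltW->].
    by rewrite lexx orbT.
  by rewrite orbT.
apply: IH => // k /HP[ka|]; first by left; rewrite (le_trans ka) ?ltW.
by rewrite inE => /predU1P[->|ks]; [left|right].
Qed.

(** Such [u] and [v] lie in a single cell of [P]: the first point of [P] beyond [u] is not before
    [v]. *)
Lemma le_mesh_separated (R : realType) (a b u v : R) P :
  itv_partition a b P -> a <= u -> u < v -> v <= b ->
  all (fun k => (k <= u) || (v <= k)) P -> v - u <= mesh a P.
Proof.
move=> [pP /eqP lP]; elim: P a pP lP => [|w P IH] a /=.
  by move=> _ -> bu uv vb; move: (le_lt_trans bu uv); rewrite ltNge vb.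
move=> /andP[aw pP] lP au uv vb /andP[wuv HP]; rewrite mesh_cons le_max.
have [wu|uw] := leP w u; first by rewrite IH ?orbT.
case/orP: wuv => [/(lt_le_trans uw)|vw]; first by rewrite ltxx.
by rewrite lerB.
Qed.

Lemma mesh_le (R : realType) (a d : R) s :
  0 <= d -> path (fun u v => v - u <= d) a s -> mesh a s <= d.
Proof.
move=> d0; elim: s a => [|y s IH] a /=; first by rewrite mesh_nil.
by case/andP=> yd /IH; rewrite mesh_cons ge_max yd.
Qed.

Lemma itv_partition_small_mesh (R : realType) (a b d : R) : a <= b -> 0 < d ->
  exists2 s, itv_partition a b s & mesh a s <= d.
Proof.
move=> ab d0; have [<-|nab] := eqVneq a b.
  by exists [::]; [split; rewrite //= | rewrite mesh_nil ltW].
have {}ab : a < b by rewrite lt_neqAle nab.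
(* [n.+1] equal steps; as [n.+1] exceeds [(b - a) / d], each step is at most [d]. *)
pose n := Num.truncn ((b - a) / d); pose h := (b - a) / n.+1%:R.
have h0 : 0 < h by rewrite divr_gt0 ?subr_gt0.
pose f := +%R^~ h.
exists (traject f (f a) n.+1); first split.
- apply: (sub_path (e := frel f)); last exact: fpath_traject.
  by move=> u v /= /eqP <-; rewrite /f ltrDl.
- rewrite last_traject; apply/eqP.
  suff -> k : iter k f a = a + h *+ k.
    by rewrite /h -mulr_natr divfK ?pnatr_eq0// subrKC.
  by elim: k => [|k IH]; rewrite ?addr0//= IH /f mulrSr addrA.
- apply: mesh_le (ltW d0) _.
  apply: (sub_path (e := frel f)); last exact: fpath_traject.
  move=> u v /= /eqP <-; rewrite /f addrC addKr /h ler_pdivrMr// mulrC.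
  by rewrite -ler_pdivrMr// ltW// real_truncnS_gt ?num_real.
Qed.

(** * Variation seminorms and their restriction to subintervals *)

Lemma le_pvar_sum (R : realType) (G : zmodType) (N : G -> R) (p a b : R)
    (x : R -> G) s :
  0 < p -> (forall v, 0 <= N v) -> (pvar (EFin \o N) p a b x < +oo)%E ->
  itv_partition a b s ->
  partition_sum (fun u v => N (x v - x u) `^ p) a s <=
  fine (pvar (EFin \o N) p a b x) `^ p.
Proof.
move=> p0 N0; rewrite /pvar; set S := esup0 _ => Sfin Ps.
have S0 : (0 <= S)%E := esup0_ge0 _.
have {}Sfin : S \is a fin_num.
  by rewrite ge0_fin_numE//; apply: lty_poweRy Sfin; rewrite invr_eq0 gt_eqF.
have : ((partition_sum (fun u v => N (x v - x u) `^ p) a s)%:E <= S)%E.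
  by apply: esup0_ub; exists s => //; rewrite /partition_sum sumEFin.
rewrite fine_poweR -powRrM mulVf ?gt_eqF// powRr1 ?fine_ge0//.
by rewrite -{1}(fineK Sfin) lee_fin.
Qed.

(** A partition of the smaller interval extends to one of the larger, which only adds nonnegative
    terms. *)
Lemma pvar_sub_itv (R : realType) (G : zmodType) (N : G -> R) (p a b c d : R)
    (x : R -> G) :
  0 < p -> (forall v, 0 <= N v) -> a <= c -> c <= d -> d <= b ->
  (pvar (EFin \o N) p c d x <= pvar (EFin \o N) p a b x)%E.
Proof.
move=> p0 N0 ac cd db; apply: gt0_ler_poweR; rewrite ?invr_ge0 ?(ltW p0)//;
  rewrite ?in_itv/= ?leey ?andbT ?esup0_ge0//.
apply: esup0_le => [|_ [s Ps <-]]; first exact: esup0_ge0.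
have [ps /eqP ls] := Ps.
(* Partitions increase strictly, so [c] and [b] are adjoined only if they differ from [a] and
   [d]. *)
pose pre := if a < c then [:: c] else [::].
pose post := if d < b then [:: b] else [::].
have lpre : last a pre = c.
  by rewrite /pre; case: ltP => //= ca; apply/eqP; rewrite eq_le ac.
have lpost : last d post = b.
  by rewrite /post; case: ltP => //= ca; apply/eqP; rewrite eq_le db.
have Pall : itv_partition a b (pre ++ s ++ post).
  split; last by rewrite !last_cat lpre ls lpost.
  rewrite !cat_path lpre ls ps /= {lpre lpost}; apply/andP; split.
    by rewrite /pre; case: ifP => //= ->.
  by rewrite /post; case: ifP => //= ->.
pose g u v := N (x v - x u) `^ p.
have g0 u v : 0 <= g u v by exact: powR_ge0.
apply: (@le_trans _ _ (partition_sum g c s)%:E).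
  by rewrite /partition_sum sumEFin.
apply: (@le_trans _ _ (partition_sum g a (pre ++ s ++ post))%:E).
  rewrite lee_fin !partition_sum_cat lpre ls.
  by rewrite ler_wpDl ?ler_wpDr ?partition_sum_ge0.
apply: esup0_ub; exists (pre ++ s ++ post) => //.
by rewrite /partition_sum sumEFin.
Qed.

(** * Uniform continuity, and limits along partitions of vanishing mesh *)

Lemma uniform_continuity_segment (R : realType) (E : normedModType R) (a b e : R)
    (x : R -> E) : {within `[a, b], continuous x} -> 0 < e ->
  exists2 d, 0 < d & forall u v, u \in `[a, b] -> v \in `[a, b] ->
    `|u - v| < d -> `|x u - x v| <= e.
Proof.
move=> /subspace_continuousP cx e0.
have e20 : 0 < e / 2 by rewrite divr_gt0.
pose P (d u : R) := forall v, v \in `[a, b] -> `|u - v| < d -> `|x u - x v| <= e.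
suff: \forall d \near (0 : R)^'+, `[a, b]%classic `<=` P d.
  move=> H; near (0 : R)^'+ => d; exists d.
    by near: d; exact: nbhs_right_gt.
  by move=> u v uab; apply: (near H d).
(* Compactness in covering form, over the filter of small positive [d]: it suffices to treat [u]
   near a fixed [u0]. *)
have /near_covering_withinP :=
  (compact_near_coveringP `[a, b]%classic).1 (@segment_compact R a b).
apply=> u0 u0ab.
have /cvgrPdist_lt /(_ _ e20) := cx u0 u0ab.
rewrite near_withinE => /nbhs_ballP[r /= r0 Hr].
have r20 : 0 < r / 2 by rewrite divr_gt0.
exists (ball u0 (r / 2), [set d | 0 < d < r / 2]) => /=.
  split; first exact: nbhsx_ballx.
  near=> d; apply/andP; split; near: d.
    exact: nbhs_right_gt.
  exact: nbhs_right_lt.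
move=> [u d] /= [u0u /andP[d0 dr]] uab v vab uvd.
rewrite -(subrKA (x u0)) [e]splitr; apply: le_trans (ler_normD _ _) _.
apply: lerD; apply: ltW.
  rewrite distrC; apply: Hr => //=; apply: lt_le_trans u0u _; lra.
apply: Hr => //=; rewrite /ball/= -(subrKA u) [r]splitr.
by apply: le_lt_trans (ler_normD _ _) (ltrD u0u (lt_trans uvd dr)).
Unshelve. all: by end_near.
Qed.

Lemma exists_partitions_mesh_cvg0 (R : realType) (a b : R) : a <= b ->
  exists2 Pi : nat -> seq R, forall n, itv_partition a b (Pi n) &
    mesh a (Pi n) @[n --> \oo] --> 0.
Proof.
move=> ab; have H n : exists s, itv_partition a b s /\ mesh a s <= n.+1%:R^-1.
  have [|s Ps ms] := itv_partition_small_mesh (d := n.+1%:R^-1) ab.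
    by rewrite invr_gt0.
  by exists s.
have /choice[Pi HPi] := H; exists Pi; first by move=> n; case: (HPi n).
apply: (@squeeze_cvgr _ _ _ _ (cst 0) (@harmonic R)); first near=> n.
- by rewrite mesh_ge0 (HPi n).2.
- exact: cvg_cst.
- exact: cvg_harmonic.
Unshelve. all: by end_near.
Qed.

(** One fixed sequence of partitions is Cauchy and provides [I]; along any other, the sums are
    eventually close to those of the fixed one, since both meshes are small. *)
Lemma cauchy_mesh_cvg (R : realType) (F : completeNormedModType R)
    (S : seq R -> F) (a b : R) : a <= b ->
  (forall e, 0 < e -> exists2 d, 0 < d & forall P Q,
    itv_partition a b P -> itv_partition a b Q -> mesh a P < d ->
    mesh a Q < d -> `|S P - S Q| <= e) ->
  exists I : F, forall Pi : nat -> seq R,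
    (forall n, itv_partition a b (Pi n)) -> mesh a (Pi n) @[n --> \oo] --> 0 ->
    S (Pi n) @[n --> \oo] --> I.
Proof.
move=> ab SC; have [Pi0 P0 m0] := exists_partitions_mesh_cvg0 ab.
have small (Pi : nat -> seq R) d : 0 < d ->
    mesh a (Pi n) @[n --> \oo] --> 0 -> \forall n \near \oo, mesh a (Pi n) < d.
  move=> d0 /cvgrPdist_lt/(_ _ d0); apply: filterS => n.
  by rewrite sub0r normrN ger0_norm ?mesh_ge0.
have /cauchy_cvgP/cvg_ex[I SI] : cauchy (S (Pi0 n) @[n --> \oo]).
  apply: cauchy_exP => e e0.
  have [|d d0 Hd] := SC (e / 2); first by rewrite divr_gt0.
  have [N _ HN] := small _ _ d0 m0; exists (S (Pi0 N)); exists N => // n /= Nn.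
  rewrite -ball_normE /=; apply: le_lt_trans (Hd _ _ (P0 N) (P0 n) _ _) _.
  - by apply: HN => /=.
  - exact: HN.
  - by rewrite ltr_pdivrMr// ltr_pMr// ltr1n.
exists I => Pi PPi mPi; apply/cvgrPdist_le => e e0.
have e20 : 0 < e / 2 by rewrite divr_gt0.
have [d d0 Hd] := SC _ e20.
move/cvgrPdist_le: SI => /(_ _ e20) SI.
have m0d := small _ _ d0 m0; have mPid := small _ _ d0 mPi.
near \oo => m; near=> n; rewrite -(subrKA (S (Pi0 m))) [e]splitr.
apply: le_trans (ler_normD _ _) (lerD _ _); first by near: m.
by apply: Hd => //; [near: m|near: n].
Unshelve. all: by end_near.
Qed.

Lemma mesh_limit_dist_le (R : realType) (F : normedModType R) (S : seq R -> F)
    (a b B : R) (I c : F) : a <= b ->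
  (forall Pi : nat -> seq R,
    (forall n, itv_partition a b (Pi n)) -> mesh a (Pi n) @[n --> \oo] --> 0 ->
    S (Pi n) @[n --> \oo] --> I) ->
  (forall P, itv_partition a b P -> `|S P - c| <= B) -> `|I - c| <= B.
Proof.
move=> ab SI SB; have [Pi P m] := exists_partitions_mesh_cvg0 ab.
apply/ler_addgt0Pl => e e0; have /cvgrPdist_le/(_ _ e0)[N _ HN] := SI _ P m.
rewrite -(subrKA (S (Pi N))); apply: le_trans (ler_normD _ _) (lerD _ _).
  exact: HN (leqnn N).
exact: SB.
Qed.

(** * Young's estimates for the germ [A_{u,v}(x_u)] *)

(** For [0 < r] the norm is finite on [hoelder_loc], so [fine] loses nothing and powers and sums can
    be taken in [R]. *)
Definition hl_norm (R : realType) (E F : normedModType R) (eta r : R)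
  (f : hoelder_loc E F eta) : R := fine (hoelder_norm eta (Dball E r) f).

Lemma hl_norm_ge0 (R : realType) (E F : normedModType R) (eta r : R)
  (f : hoelder_loc E F eta) : 0 <= hl_norm r f.
Proof. by rewrite fine_ge0 ?hoelder_norm_ge0. Qed.

Lemma hl_norm_dist_le (R : realType) (E F : normedModType R) (eta r : R)
    (f : hoelder_loc E F eta) (u v : E) : 0 < r -> `|u| <= r -> `|v| <= r ->
  `|f u - f v| <= hl_norm r f * `|u - v| `^ eta.
Proof.
move=> r0 ur vr; have [->|uv] := eqVneq u v.
  by rewrite subrr normr0 mulr_ge0 ?hl_norm_ge0 ?powR_ge0.
rewrite -ler_pdivrMr ?powR_gt0 ?normr_gt0 ?subr_eq0// -lee_fin.
rewrite fineK ?hl_norm_fin_num//; apply: le_trans (leeDr _ (esup0_ge0 _)).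
by apply: esup0_ub; exists (u, v) => //; split => //; apply/eqP.
Qed.

Section young_integral.
Context {R : realType} {E F : normedModType R} {eta : R}.
Context (A : R -> hoelder_loc E F eta) (x : R -> E) (s t r p : R).
Context (r0 : 0 < r) (eta0 : 0 < eta) (p1 : 1 <= p)
  (xr : forall u, s <= u <= t -> `|x u| <= r).

Local Notation germ := (fun u v => (A v - A u) (x u)).
Local Notation dA := (fun u v => hl_norm r (A v - A u) `^ p).
Local Notation dx q := (fun u v => `|x v - x u| `^ q).

(** Here [q] is a free exponent, so that the lemma serves for the original [q] and for a larger one.
    Bounds are asked only of partitions containing the kept points, which allows bounds that hold at
    small scales only. *)
Lemma young_coarsen (q W1 W2 : R) (K : pred R) P :
  0 < q -> 1 < p^-1 + eta / q -> itv_partition s t P -> K t ->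
  (forall Q, itv_partition s t Q -> subseq [seq u <- P | K u] Q ->
    partition_sum dA s Q <= W1 /\ partition_sum (dx q) s Q <= W2) ->
  `|partition_sum germ s P - partition_sum germ s [seq u <- P | K u]| <=
  young_const (p^-1 + eta / q) * (W1 `^ p^-1 * W2 `^ (eta / q)).
Proof.
move=> q0 th1 PP Kt HW; have [_ /eqP lP] := PP.
have p0 : 0 < p := lt_le_trans ltr01 p1.
apply: (@partition_sum_coarsen _ _ germ dA (dx q) K
  [pred u | s <= u <= t]) => //.
- by rewrite invr_gt0.
- by rewrite divr_gt0.
- by move=> u v /=; exact: powR_ge0.
- move=> u y z ust yst zst.
  rewrite -!powRrM mulfV ?gt_eqF// powRr1 ?hl_norm_ge0//.
  rewrite mulrCA mulfV ?gt_eqF// mulr1.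
  (* Additivity in time leaves the single increment [A z - A y], evaluated at [x y] and at [x u],
     where its Hölder bound applies. *)
  have -> : (A y - A u) (x u) + (A z - A y) (x y) - (A z - A u) (x u) =
      (A z - A y) (x y) - (A z - A y) (x u).
    have -> : (A z - A u) (x u) = (A z - A y) (x u) + (A y - A u) (x u).
      by rewrite -(subrKA (A y)).
    by rewrite [X in X - _]addrC opprD addrACA subrr addr0.
  by apply: hl_norm_dist_le; rewrite ?xr.
- move=> Q QP PQ lQ; apply: HW => //; exact: itv_partition_subseq PP QP lQ.
- by apply/allP => u /(itv_partition_mem PP).
- by rewrite lP.
Qed.

Context (q V1 V2 : R) (q1 : 1 <= q) (th1 : 1 < p^-1 + eta / q)
  (HV1 : forall Q, itv_partition s t Q -> partition_sum dA s Q <= V1 `^ p)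
  (HV2 : forall Q, itv_partition s t Q -> partition_sum (dx q) s Q <= V2 `^ q).

(** Keeping only the end point [t] coarsens the sum to [germ s t]. *)
Lemma young_estimate P : 0 <= V1 -> itv_partition s t P ->
  `|partition_sum germ s P - germ s t| <=
  young_const (p^-1 + eta / q) * (V1 * V2 `^ eta).
Proof.
move=> V10 PP; have p0 : 0 < p := lt_le_trans ltr01 p1.
have q0 : 0 < q := lt_le_trans ltr01 q1.
have := @young_coarsen q (V1 `^ p) (V2 `^ q) (pred1 t) P q0 th1 PP (eqxx t).
rewrite -!powRrM mulfV ?gt_eqF// powRr1// [q * _]mulrCA mulfV ?gt_eqF// mulr1.
have -> : partition_sum germ s [seq u <- P | pred1 t u] = germ s t.
  have [pP /eqP lP] := PP; have [ts|ts] := eqVneq s t.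
    have -> : P = [::] by apply: (@itv_partitionxx _ _ s); rewrite {2}ts.
    by rewrite partition_sum_nil ts subrr.
  rewrite filter_pred1_uniq ?partition_sum_cons ?partition_sum_nil ?addr0//.
    exact: lt_sorted_uniq (path_sorted pP).
  rewrite -lP; case: (P) lP ts => [/= ->|y P' _ _ /=]; rewrite ?eqxx//.
  exact: mem_last.
by apply => Q PQ _; split; [exact: HV1|exact: HV2].
Qed.

(* Trading [q] for a slightly larger [q'] keeps the exponent above 1, and the
   [q']-variation sums along partitions refining [P] are at most
   [e `^ (q' - q)] times the [q]-variation, where [e] is the oscillation of [x]
   at scale [mesh s P]. *)
Lemma young_refinement (e : R) : {within `[s, t], continuous x} -> 0 < e ->
  exists2 d, 0 < d & forall P Q, itv_partition s t P -> itv_partition s t Q ->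
    mesh s P < d -> [seq u <- Q | u \in P] = P ->
    `|partition_sum germ s Q - partition_sum germ s P| <= e.
Proof.
move=> cx e0; have p0 : 0 < p := lt_le_trans ltr01 p1.
have q0 : 0 < q := lt_le_trans ltr01 q1.
have al1 : p^-1 <= 1 by rewrite invf_le1.
have al0 : 0 < p^-1 by rewrite invr_gt0.
have be0 : 0 < eta / q by rewrite divr_gt0.
set al := p^-1 in al1 al0 *; set be := eta / q in be0 *.
have ab1 : 1 < al + be := th1.
(* The midpoint of [1 - al] and [be], where [1 - al < be] by [th1]: [al + be'] still exceeds 1,
   while [q' = eta / be'] exceeds [q]. *)
pose be' := (be + (1 - al)) / 2.
have be'0 : 0 < be' by rewrite /be'; lra.
have be'be : be' < be by rewrite /be'; lra.
pose q' := eta / be'.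
have q'0 : 0 < q' by rewrite divr_gt0.
have eq' : eta / q' = be' by rewrite /q' invf_div mulrCA mulfV ?gt_eqF// mulr1.
have qq' : 0 < q' - q.
  rewrite subr_gt0 /q' ltr_pdivlMr// mulrC -ltr_pdivlMr//.
have ab'1 : 1 < al + eta / q' by rewrite eq' /be'; lra.
pose L := young_const (al + eta / q') *
  ((V1 `^ p) `^ al * (V2 `^ q) `^ (eta / q')).
have L0 : 0 <= L.
  by apply: mulr_ge0; [exact/ltW/young_const_gt0|rewrite mulr_ge0 ?powR_ge0].
have k0 : 0 < (q' - q) * be' by rewrite mulr_gt0.
(* Oscillation [e1] multiplies the bound [L] by [e1] to the power [(q' - q) * be'], which is
   [e / (L + 1)] by this choice; the added 1 covers [L = 0]. *)
pose e1 := (e / (L + 1)) `^ ((q' - q) * be')^-1.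
have eL0 : 0 < e / (L + 1) by rewrite divr_gt0// ltr_wpDl.
have e10 : 0 < e1 by rewrite powR_gt0.
have [d d0 Hd] := uniform_continuity_segment cx e10.
exists d => // P Q PP PQ mP QP; have [pP /eqP lP] := PP.
have [ts|ts] := eqVneq s t.
  have P0 : P = [::] by apply: (@itv_partitionxx _ _ s); rewrite {2}ts.
  have Q0 : Q = [::] by apply: (@itv_partitionxx _ _ s); rewrite {2}ts.
  by rewrite P0 Q0 subrr normr0 ltW.
rewrite -{1}QP.
apply: le_trans (@young_coarsen q' (V1 `^ p) (e1 `^ (q' - q) * V2 `^ q)
  (mem P) Q q'0 ab'1 PQ _ _) _.
- rewrite /= -{1}lP; case: (P) lP ts => [/= ->|y P' _ _ /=]; rewrite ?eqxx//.
  exact: mem_last.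
- move=> Q' PQ' PQ'sub; split; first exact: HV1.
  apply: (@le_trans _ _ (e1 `^ (q' - q) * partition_sum (dx q) s Q'));
    last by rewrite ler_wpM2l ?powR_ge0 ?HV2.
  rewrite mul_partition_sum; apply: partition_sum_le.
  have [pQ' _] := PQ'.
  (* [Q'] contains the points of [P], so its consecutive points share a cell of [P] and are less
     than [d] apart. *)
  have PQ'mem : {in P, forall k, k <= s \/ k \in Q'}.
    by move=> k; rewrite -QP => /(mem_subseq PQ'sub); right.
  have := path_separated pQ' PQ'mem.
  apply: (sub_in_path (P := mem (s :: Q'))); last exact/allP.
  move=> u v uQ' vQ' /andP[uv sep].
  have /andP[su ut] := itv_partition_mem PQ' uQ'.
  have /andP[sv vt] := itv_partition_mem PQ' vQ'.
  have uvd := le_mesh_separated PP su uv vt sep.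
  have -> : `|x v - x u| `^ q' = `|x v - x u| `^ (q' - q) * `|x v - x u| `^ q.
    by rewrite -powRD subrK// (gt_eqF q'0).
  rewrite ler_wpM2r ?powR_ge0//.
  apply: ge0_ler_powR; rewrite ?nnegrE ?(ltW qq') ?(ltW e10)//.
  apply: Hd; rewrite ?in_itv /= ?su ?sv//.
  by rewrite gtr0_norm ?subr_gt0//; exact: le_lt_trans uvd mP.
have -> : (e1 `^ (q' - q) * V2 `^ q) `^ (eta / q') =
    e / (L + 1) * (V2 `^ q) `^ (eta / q').
  rewrite powRM ?powR_ge0//; congr (_ * _).
  by rewrite eq' -powRrM /e1 -powRrM mulVf ?gt_eqF// powRr1 ?ltW.
apply: (@le_trans _ _ (L * (e / (L + 1)))).
  by rewrite [X in _ * X]mulrCA [leLHS]mulrCA mulrC.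
by rewrite mulrA ler_pdivrMr ?ltr_wpDl// mulrC ler_wpM2l ?(ltW e0)// lerDl.
Qed.

(** Both sums are compared with the sum over a common refinement. *)
Lemma young_cauchy (e : R) : {within `[s, t], continuous x} -> 0 < e ->
  exists2 d, 0 < d & forall P Q, itv_partition s t P -> itv_partition s t Q ->
    mesh s P < d -> mesh s Q < d ->
    `|partition_sum germ s P - partition_sum germ s Q| <= e.
Proof.
move=> cx e0; have [|d d0 Hd] := young_refinement (e := e / 2) cx.
  by rewrite divr_gt0.
exists d => // P Q PP PQ mP mQ.
have [S [PS SP SQ]] := itv_partition_common_refinement PP PQ.
rewrite -(subrKA (partition_sum germ s S)) [e]splitr.
apply: le_trans (ler_normD _ _) (lerD _ _); last exact: Hd.
by rewrite distrC; exact: Hd.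
Qed.

End young_integral.

(** * Existence of the integral and the final estimate *)

Lemma bounded_on_segment (R : realType) (E : normedModType R) (a b : R)
    (x : R -> E) : {within `[a, b], continuous x} ->
  exists2 r, 0 < r & forall u, a <= u <= b -> `|x u| <= r.
Proof.
move=> cx; have /compact_bounded [M [Mr HM]] :=
  continuous_compact cx (@segment_compact R a b).
exists (`|M| + 1); first by rewrite ltr_wpDl.
move=> u uab; apply: (HM (`|M| + 1)).
  by rewrite (le_lt_trans (real_ler_norm Mr))// ltrDl.
by exists u => //=; rewrite in_itv.
Qed.

Theorem theorem3p1 (R : realType) :
  exists C : R -> R, (forall theta : R, 1 < theta -> 0 < C theta) /\
  forall (E F : completeNormedModType R) (T eta p q theta : R),
    0 < T -> 0 < eta -> eta <= 1 -> 1 <= p -> 1 <= q ->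
    theta = p^-1 + eta / q -> 1 < theta ->
  forall (A : R -> hoelder_loc E F eta) (x : R -> E),
    Cpvar_tvs p 0 T A -> Cpvar q 0 T x ->
  exists I : R -> R -> F,
    (forall s t : R, 0 <= s -> s <= t -> t <= T ->
       is_nonlinear_young_integral A x s t (I s t)) /\
    (forall s t r : R, 0 <= s -> s <= t -> t <= T ->
       0 < r -> (sup_norm T x <= r%:E)%E ->
       (`|I s t - (A t - A s)%R (x s)|%:E <=
          (C theta)%:E *
          pvar (fun f : hoelder_loc E F eta => hoelder_norm eta (Dball E r) f)
            p s t A *
          pvar (@norme R E) q s t x `^ eta)%E).
Proof.
exists (@young_const R); split=> [theta|]; first exact: young_const_gt0.
move=> E F T eta p q theta T0 eta0 eta1 p1 q1 -> th1 A x [_ finA] [cx finx].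
have p0 : 0 < p := lt_le_trans ltr01 p1.
have q0 : 0 < q := lt_le_trans ltr01 q1.
pose V1 r s t := fine (pvar (EFin \o hl_norm r) p s t A).
pose V2 s t := fine (pvar (@norme R E) q s t x).
have finA' (r s t : R) : 0 < r -> 0 <= s -> s <= t -> t <= T ->
    (pvar (EFin \o hl_norm r) p s t A < +oo)%E.
  move=> r0 s0 st tT; apply: le_lt_trans (pvar_sub_itv _ p0 _ s0 st tT) _.
    by move=> v; exact: hl_norm_ge0.
  (* The Fréchet-space condition on [A] is tested on the continuous seminorm [hl_norm r]. *)
  by apply: finA; [exact: hl_norm_seminorm|exact: hl_norm_continuous].
have finx' (s t : R) : 0 <= s -> s <= t -> t <= T ->
    (pvar (@norme R E) q s t x < +oo)%E.
  move=> s0 st tT; apply: le_lt_trans finx.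
  by apply: (@pvar_sub_itv R E (fun v => `|v|)) => // v.
have HV1 (r s t : R) : 0 < r -> 0 <= s -> s <= t -> t <= T -> forall Q,
    itv_partition s t Q ->
    partition_sum (fun u v => hl_norm r (A v - A u) `^ p) s Q <= V1 r s t `^ p.
  move=> r0 s0 st tT Q PQ; apply: le_pvar_sum => //; last exact: finA'.
  by move=> v; exact: hl_norm_ge0.
have HV2 (s t : R) : 0 <= s -> s <= t -> t <= T ->
    forall Q, itv_partition s t Q ->
    partition_sum (fun u v => `|x v - x u| `^ q) s Q <= V2 s t `^ q.
  move=> s0 st tT Q PQ; apply: (@le_pvar_sum R E (fun v => `|v|)) => //.
  exact: finx'.
have V10 r s t : 0 <= V1 r s t by rewrite fine_ge0 ?poweR_ge0.
(* This radius serves for existence, where none is given; the estimate works with the given [r]. *)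
have [r0 r00 xr0] := bounded_on_segment cx.
have subT (s t u : R) : 0 <= s -> t <= T -> s <= u <= t -> 0 <= u <= T.
  by move=> s0 tT /andP[su ut]; rewrite (le_trans s0 su) (le_trans ut tT).
(* The conditions on the end points stand under the existential so that [choice] gives a total
   function; other pairs get the dummy witness 0. *)
have exI (st : R * R) : exists I : F, 0 <= st.1 -> st.1 <= st.2 -> st.2 <= T ->
    is_nonlinear_young_integral A x st.1 st.2 I.
  case: st => s t /=.
  have [[s0 st tT]|nst] := pselect [/\ 0 <= s, s <= t & t <= T];
    last by exists 0 => s0 st tT; case: nst.
  have cst : {within `[s, t], continuous x}.
    apply: continuous_subspaceW cx => u /=; rewrite !in_itv/=; exact: subT.
  have [|I HI] := @cauchy_mesh_cvg _ _
      (partition_sum (fun u v => (A v - A u) (x u)) s) _ _ st; last by exists I.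
  have xr u : s <= u <= t -> `|x u| <= r0 by move=> /(subT s t u s0 tT)/xr0.
  by move=> e e0; exact: (young_cauchy r00 eta0 p1 xr q1 th1
    (HV1 r0 s t r00 s0 st tT) (HV2 s t s0 st tT) cst e0).
have [I HI] := choice exI.
exists (fun s t => I (s, t)); split=> [s t s0 st tT|s t r s0 st tT r1 xr].
  exact: (HI (s, t)).
have xr' u : s <= u <= t -> `|x u| <= r.
  move=> ust; rewrite -lee_fin; apply: le_trans xr; apply: esup0_ub.
  by exists u => //=; rewrite in_itv /= (subT s t).
(* All norms and variations are finite, so the claim becomes a real inequality, valid for every
   partition sum and then in the limit. *)
have -> : (fun f : hoelder_loc E F eta => hoelder_norm eta (Dball E r) f) =
    EFin \o hl_norm r.
  by apply/funext => f /=; rewrite fineK ?hl_norm_fin_num.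
have -> : pvar (EFin \o hl_norm r) p s t A = (V1 r s t)%:E.
  by rewrite fineK// ge0_fin_numE ?poweR_ge0 ?finA'.
have -> : pvar (@norme R E) q s t x = (V2 s t)%:E.
  by rewrite fineK// ge0_fin_numE ?poweR_ge0 ?finx'.
rewrite poweR_EFin -!EFinM lee_fin -mulrA.
apply: (mesh_limit_dist_le st (HI (s, t) s0 st tT)) => P PP.
exact: (young_estimate r1 eta0 p1 xr' q1 th1
  (HV1 r s t r1 s0 st tT) (HV2 s t s0 st tT) (V10 r s t) PP).
Qed.
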